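(* Let $(T_n)_{n\ge 1}$ be a uniform random recursive tree and let $R_n$ be the betweenness rank of the root (vertex $1$) in $T_n$. Then $\mathbb{E}R_n=\Theta(\log n)$ as $n\to\infty$.
   Context: A uniform random recursive tree (URRT) is a random sequence of trees $(T_n)_{n\ge 1}$ with $V(T_n)=[n]=\{1,\ldots,n\}$: $T_1$ is the single vertex $1$ (the root), and $T_{n+1}$ is obtained from $T_n$ by adding vertex $n+1$ and an edge $\{i,n+1\}$, where $i$ is chosen uniformly at random from $[n]$, independently of the past. The betweenness centrality of $v\in V(T_n)$ is $\mathcal{B}_{T_n}(v)=\sum_{s,t\in V(T_n):\,s,t\ne v}\mathbf{1}_{\{v\in\sigma_{s,t}\}}$, where $\sigma_{s,t}$ is the path between $s$ and $t$ in $T_n$ excluding $s$ and $t$; larger values correspond to more central vertices. Ranking: vertices are ordered from most to least central; vertices with equal centrality value are ordered in reverse order of insertion time (if $u,v$ have equal centrality, $u$ is ranked before $v$ iff $u>v$). This gives a permutation $\gamma_n$ of $[n]$, where $\gamma_n(v)\in\{1,\ldots,n\}$ is the position of $v$ in this order (position $1$ being most central). The rank of the root is $R_n=\gamma_n(1)$. *)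

(* Defs.v *)
From HB Require Import structures.
From mathcomp Require Import all_boot all_order all_algebra.
From mathcomp Require Import all_classical all_reals all_analysis.
Set Implicit Arguments.
Unset Strict Implicit.
Unset Printing Implicit Defensive.
Import Order.TTheory GRing.Theory Num.Theory.
Import numFieldNormedType.Exports.
Local Open Scope classical_set_scope.
Local Open Scope ring_scope.

(* Finite graphs whose vertices are natural numbers. *)
Record ngraph := NGraph { vertices : seq nat; adj : rel nat }.

Definition single_vertex (v : nat) : ngraph :=
  NGraph [:: v] (fun _ _ => false).

Definition attach_leaf (G : ngraph) (i v : nat) : ngraph :=
  NGraph (rcons (vertices G) v)
    (fun x y => [|| adj G x y, (x == i) && (y == v) | (x == v) && (y == i)]).

Definition simple_path (G : ngraph) (s t : nat) (p : seq nat) : bool :=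
  [&& path (adj G) s p, last s p == t & uniq (s :: p)].

(* The vertices of the path from s to t, both endpoints excluded. In a tree
   the simple path is unique, so the existential picks out that path. *)
Definition path_interior (G : ngraph) (s t : nat) : set nat :=
  [set v | [/\ v != s, v != t & exists2 p, simple_path G s t p & v \in s :: p]].

(* The sum is over ordered pairs (s, t). *)
Definition betweenness (G : ngraph) (v : nat) : nat :=
  (\sum_(s <- vertices G | s != v) \sum_(t <- vertices G | t != v)
     (v \in path_interior G s t))%N.

(* Most central first; among equally central vertices the larger label, that is
   the later inserted vertex, comes first. *)
Definition ranked_no_later (G : ngraph) : rel nat := fun u v =>
  (betweenness G v < betweenness G u)%N ||
  ((betweenness G u == betweenness G v) && (v <= u)%N).

(* Positions are counted from 1. *)
Definition betweenness_rank (G : ngraph) (v : nat) : nat :=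
  (index v (sort (ranked_no_later G) (vertices G))).+1.

(* U n is the vertex of {1, ..., n} to which vertex n+1 is attached; the list
   [:: U 1 w; ...; U n.-1 w] records the past of step n. The values of T 0 and
   U 0 are irrelevant. U n lies in {1, ..., n} almost surely, by uniformity. *)
Record URRT d (Omega : measurableType d) (R : realType)
    (P : probability Omega R) (U : nat -> {RV P >-> nat})
    (T : nat -> Omega -> ngraph) : Prop := MkURRT {
  URRT_root : forall w, T 1 w = single_vertex 1;
  URRT_step : forall n w, (1 <= n)%N ->
    T n.+1 w = attach_leaf (T n w) (U n w) n.+1;
  URRT_uniform : forall n i, (1 <= i <= n)%N ->
    P (U n @^-1` [set i]) = (n%:R^-1)%:E;
  URRT_indep : forall n (A : set nat) (C : set (seq nat)), (1 <= n)%N ->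
    let past w := [seq U k w | k <- iota 1 n.-1] in
    P (U n @^-1` A `&` past @^-1` C) = (P (U n @^-1` A) * P (past @^-1` C))%E
}.

Definition is_URRT d (Omega : measurableType d) (R : realType)
    (P : probability Omega R) (T : nat -> Omega -> ngraph) : Prop :=
  exists U : nat -> {RV P >-> nat}, URRT U T.

(* Main.v *)
Require Import Defs.
From mathcomp Require Import all_boot all_order all_algebra zify ring lra.
From mathcomp Require Import all_classical all_reals all_analysis.
From mathcomp Require Import measurable_realfun.
Import Order.TTheory GRing.Theory Num.Theory.
Import numFieldNormedType.Exports.
Local Open Scope classical_set_scope.
Local Open Scope ring_scope.
Set Implicit Arguments.
Unset Strict Implicit.

(* The rank of the root counts the vertices [v] with [B v >= B 1]. In a tree on
   [n] vertices let [m] be the size of the subtree of [v] and [a] the size of the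
   subtree of the child of the root above [v]. Counting pairs on either side of
   the edges above these two vertices,
     2 (m - 1) (n - m) <= B v <= (n - 1)^2 - (n - m)^2,
     2 a (n - 1 - a) <= B 1 <= (n - 1)^2 - a^2.
   Hence [B v >= B 1] forces [a (n - a) <= n m], and it follows from
   [2 (n - a) <= m <= n / 2]. In a recursive tree the expected number of
   non-root vertices with given [a] and [m], for [1 <= m <= a < n], is
   [1 / (m (m + 1))] if [m < a] and [1 / a] if [m = a], by induction on [n].
   Summing over the two regions bounds the expected rank by [1 + 3 H_(n-1)] from
   above and by [ln (n / 8) / 4] from below. *)

(** * Betweenness in a recursive tree *)

Section RecursiveTrees.
Local Open Scope nat_scope.

Implicit Types (h : seq nat) (u v w x y i : nat).

(* Histories are stored in reverse: the head of [h] is the parent of the last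
   inserted vertex, whose label is [(size h).+1]. *)
Fixpoint tree_of h : ngraph :=
  if h is i :: h' then attach_leaf (tree_of h') i (size h').+2
  else single_vertex 1.

Fixpoint wf_history h : bool :=
  if h is i :: h' then (1 <= i <= (size h').+1) && wf_history h' else true.

Definition labels h := iota 1 (size h).+1.

Fixpoint parent h v : nat :=
  if h is i :: h' then if v == (size h').+2 then i else parent h' v else 0.

(** The ancestor comes first, so that [descends h u] is the subtree of [u]. *)
Fixpoint descends h u v : bool :=
  if h is i :: h' then
    if v == (size h').+2 then (u == v) || descends h' u i else descends h' u v
  else u == v.

(* The child of the root whose subtree contains [v]. *)
Fixpoint branch h v : nat :=
  if h is i :: h' then
    if v == (size h').+2 then (if i == 1 then v else branch h' i)
    else branch h' v
  else v.

Definition subtree_size h u := count (descends h u) (labels h).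

Lemma labelsS i h : labels (i :: h) = rcons (labels h) (size h).+2.
Proof.
by rewrite /labels -cats1 -[[:: _]]/(iota (1 + (size h).+1) 1) -iotaD addn1.
Qed.

Lemma mem_labels h v : (v \in labels h) = (1 <= v <= (size h).+1).
Proof. by rewrite mem_iota; lia. Qed.

Lemma labelsE h : labels h = 1 :: iota 2 (size h).
Proof. by []. Qed.

Lemma uniq_labels h : uniq (labels h).
Proof. exact: iota_uniq. Qed.

Lemma size_labels h : size (labels h) = (size h).+1.
Proof. exact: size_iota. Qed.

Local Opaque labels.

Lemma vertices_tree_of h : vertices (tree_of h) = labels h.
Proof. by elim: h => [|i h IH]; [rewrite labelsE|rewrite labelsS /= IH]. Qed.

Lemma adj_tree_sym h : symmetric (adj (tree_of h)).
Proof.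
elim: h => [//|i h IH] x y /=; rewrite IH.
by case: (adj _ y x); case: (x == i); case: (y == i); case: (x == _); case: (y == _).
Qed.

Lemma adj_tree_labels h x y :
  wf_history h -> adj (tree_of h) x y -> 1 <= x <= (size h).+1.
Proof.
elim: h => [//|i h IH] /= /andP[Hi Hh] /or3P[/(IH Hh)|/andP[/eqP-> _]|/andP[/eqP-> _]];
lia.
Qed.

Lemma adj_tree_labelsr h x y :
  wf_history h -> adj (tree_of h) x y -> 1 <= y <= (size h).+1.
Proof. by rewrite adj_tree_sym; exact: adj_tree_labels. Qed.

Lemma descends_refl h v : descends h v v.
Proof. by elim: h => [|i h IH] /=; rewrite ?eqxx //; case: ifP. Qed.

Lemma descends_leq h u v : wf_history h -> v <= (size h).+1 ->
  descends h u v -> u <= v.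
Proof.
elim: h v => [|i h IH] v /=; first by move=> _ _ /eqP->.
move=> /andP[/andP[i0 Hi] Hh] Hv; case: eqVneq => [->|Hne].
  by case/orP => [/eqP->//|/(IH i Hh Hi)]; lia.
by apply: IH => //; lia.
Qed.

(** A new leaf lies in the subtree of an older [v] exactly when its neighbour does, so the new edge
    leaves that subtree only when the leaf is [v] itself. All four betweenness bounds rest on this
    one-edge cut. *)
Lemma descends_cross h v x y : wf_history h -> v <= (size h).+1 ->
  adj (tree_of h) x y -> descends h v x -> ~~ descends h v y ->
  x = v /\ y = parent h v.
Proof.
elim: h => [//|i h IH] /= /andP[/andP[i0 Hi] Hh] Hv.
have adjN z w : adj (tree_of h) z w ->
    (z == (size h).+2 = false) /\ (w == (size h).+2 = false).
  by move=> H; have := adj_tree_labels Hh H; have := adj_tree_labelsr Hh H; lia.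
have i2 : (i == (size h).+2) = false by lia.
case/or3P => [Hadj|/andP[/eqP-> /eqP->]|/andP[/eqP-> /eqP->]].
- have [-> ->] := adjN _ _ Hadj.
  case: eqVneq => [Ev|nv]; last by apply: IH => //; lia.
  move=> Hd; have /andP[_ Hx] := adj_tree_labels Hh Hadj.
  move: (descends_leq Hh Hx Hd); lia.
- by rewrite eqxx i2 negb_or => -> /andP[].
- rewrite eqxx i2; case/orP => [/eqP<-|->] //; by rewrite eqxx.
Qed.

Lemma tree_path_root h x : wf_history h -> x \in labels h ->
  exists2 p, path (adj (tree_of h)) x p & last x p = 1.
Proof.
elim: h x => [|i h IH] x /=.
  by rewrite mem_labels /= => _ Hx; exists [::] => //=; lia.
move=> /andP[/andP[i0 Hi] Hh]; rewrite labelsS mem_rcons inE => Hx.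
have sub : subrel (adj (tree_of h)) (adj (tree_of (i :: h))).
  by move=> a b /= ->.
case/orP: Hx => [/eqP->|/(IH _ Hh)[p Hp Hl]]; last first.
  by exists p => //; apply: sub_path Hp.
have [|p Hp Hl] := IH i Hh; first by rewrite mem_labels i0.
exists (i :: p) => //=; rewrite !eqxx /= !orbT /=.
exact: sub_path Hp.
Qed.

Lemma tree_simple_path h x y : wf_history h -> x \in labels h ->
  y \in labels h -> exists p, simple_path (tree_of h) x y p.
Proof.
move=> Hh /(tree_path_root Hh)[p Hp lp] /(tree_path_root Hh)[q Hq lq].
(* From [x] to the root, then back along the path of [y]; shortening makes the walk simple. *)
have Hr : path (adj (tree_of h)) x (p ++ rev (belast y q)).
  rewrite cat_path Hp lp -lq rev_path /=.
  by under eq_path => a b do rewrite adj_tree_sym.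
have Hl : last x (p ++ rev (belast y q)) = y.
  rewrite last_cat lp -lq; case: q {Hq lq Hr} => [//|z q] /=.
  by rewrite rev_cons last_rcons.
move: Hl; case/shortenP: Hr => p' Hp' Hu _ Hl.
by exists p'; rewrite /simple_path Hp' Hu Hl eqxx.
Qed.


(** * Paths and a cut consisting of one edge *)

Lemma path_stays (e : rel nat) (A : pred nat) q x p :
  (forall a b, e a b -> A a -> ~~ A b -> b = q) ->
  path e x p -> q \notin p -> A x -> all A p.
Proof.
move=> He; elim: p x => [//|z p IH] x /= /andP[xz zp].
rewrite inE negb_or => /andP[qz qp] Ax.
have Az : A z by apply: contraNT qz => Nz; rewrite (He x z).
by rewrite Az (IH z).
Qed.

(** A visit to [A] starts from [q], and leaving [A] again would use [q] a second time. *)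
Lemma path_no_crossing (e : rel nat) (A : pred nat) c q s p :
  symmetric e -> (forall a b, e a b -> A a -> ~~ A b -> a = c /\ b = q) ->
  path e s p -> uniq (s :: p) -> ~~ A s -> ~~ A (last s p) ->
  all (predC A) (s :: p).
Proof.
move=> se He; elim: p s => [|z p IH] s; first by rewrite /= andbT.
move=> /= /andP[sz zp] /andP[nz uz] As Al; rewrite As.
have [Az|Az] := boolP (A z); last by have /= /andP[_ ->] := IH z zp uz Az Al.
have [_ sq] : z = c /\ s = q by apply: He => //; rewrite se.
move: nz; rewrite inE negb_or sq => /andP[_ qp].
have := @path_stays e A q z p (fun a b ab Aa Ab => proj2 (He a b ab Aa Ab)) zp qp Az.
by move=> /allP Ap; move: (mem_last z p); rewrite inE => /orP[/eqP E|/Ap];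
  [move: Al; rewrite E Az|rewrite (negPf Al)].
Qed.

(** The first step out of [A] is the cut edge, so both of its ends are on the path. *)
Lemma path_crosses (e : rel nat) (A : pred nat) c q s p :
  (forall a b, e a b -> A a -> ~~ A b -> a = c /\ b = q) ->
  path e s p -> A s -> ~~ A (last s p) -> (c \in s :: p) && (q \in s :: p).
Proof.
move=> He; elim: p s => [|z p IH] s /=; first by move=> _ ->.
move=> /andP[sz zp] As Al; have [Az|Az] := boolP (A z).
  by have /andP[cz qz] := IH z zp Az Al; rewrite inE cz orbT inE qz orbT.
by have [-> ->] := He _ _ sz As Az; rewrite !inE !eqxx /= orbT.
Qed.

Lemma path_interior_sym G s t x : symmetric (adj G) ->
  path_interior G s t x -> path_interior G t s x.
Proof.
move=> sG [xs xt [p /and3P[Hp /eqP lp up] xp]]; split=> //.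
have Er : rev (s :: p) = t :: rev (belast s p) by rewrite lastI rev_rcons lp.
exists (rev (belast s p)); last by rewrite -Er mem_rev.
rewrite /simple_path -Er rev_uniq up andbT -lp rev_path /=.
rewrite (eq_path (e' := adj G)) => [|a b]; last by rewrite sG.
rewrite Hp /=; case: p {Er Hp up xp} lp => [|y p _] /=; first by move=> ->.
by rewrite rev_cons last_rcons.
Qed.

(** * Betweenness bounds from subtree sizes *)

(** Ordered pairs inside [A] contribute nothing, all others at most one each. *)
Lemma betweenness_le G x (A : pred nat) :
  (forall s t, s != x -> t != x -> A s -> A t -> ~ path_interior G s t x) ->
  betweenness G x + count (predI A (predC1 x)) (vertices G) ^ 2
    <= count (predC1 x) (vertices G) ^ 2.
Proof.
move=> HA; set V' := [seq s <- vertices G | s != x].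
have -> : betweenness G x = \sum_(s <- V') \sum_(t <- V') (x \in path_interior G s t).
  by rewrite /betweenness big_filter; apply: eq_bigr => s _; rewrite big_filter.
have E (a : pred nat) : count (predI a (predC1 x)) (vertices G) = \sum_(s <- V') a s.
  rewrite big_filter -sum1_count big_mkcond [RHS]big_mkcond /=.
  by apply: eq_bigr => s _ /=; case: (a s); case: (s == x).
have -> : count (predC1 x) (vertices G) = \sum_(s <- V') 1.
  by rewrite big_filter sum1_count.
rewrite E -!mulnn !big_distrl /= -big_split /= big_seq [leqRHS]big_seq.
apply: leq_sum => s; rewrite mem_filter => /andP[sx _].
rewrite !big_distrr /= -big_split /= big_seq [leqRHS]big_seq; apply: leq_sum => t.
rewrite mem_filter => /andP[tx _].
case As : (A s); case At : (A t); rewrite ?mul0n ?muln0 ?addn0 ?leq_b1 //.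
by rewrite memNset //; apply: HA.
Qed.

(** Each pair separated by [A] counts in both orders, whence the factor 2. *)
Lemma leq_betweenness G x (A : pred nat) : symmetric (adj G) ->
  (forall s t, s \in vertices G -> t \in vertices G -> s != x -> t != x ->
     A s -> ~~ A t -> path_interior G s t x) ->
  2 * count (predI A (predC1 x)) (vertices G) *
    count (predI (predC A) (predC1 x)) (vertices G) <= betweenness G x.
Proof.
move=> sG HA.
set V' := [seq s <- vertices G | s != x].
have -> : betweenness G x = \sum_(s <- V') \sum_(t <- V') (x \in path_interior G s t).
  by rewrite /betweenness big_filter; apply: eq_bigr => s _; rewrite big_filter.
have E (a : pred nat) : count (predI a (predC1 x)) (vertices G) = \sum_(s <- V') a s.
  rewrite big_filter -sum1_count big_mkcond [RHS]big_mkcond /=.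
  by apply: eq_bigr => s _ /=; case: (a s); case: (s == x).
rewrite !E -mulnA mul2n -addnn {1}mulnC !big_distrl /= -big_split /=.
rewrite big_seq [leqRHS]big_seq.
apply: leq_sum => s; rewrite mem_filter => /andP[sx sV].
rewrite !big_distrr /= -big_split /= big_seq [leqRHS]big_seq; apply: leq_sum => t.
rewrite mem_filter => /andP[tx tV].
case As : (A s); case At : (A t) => //=.
  by rewrite mem_set //; apply: HA; rewrite ?At.
by rewrite mem_set //; apply: path_interior_sym => //; apply: HA; rewrite ?As.
Qed.


Lemma count_predD1 (a : pred nat) x (s : seq nat) : uniq s -> x \in s ->
  count (predI a (predC1 x)) s + a x = count a s.
Proof.
elim: s => [//|y s IH] /= /andP[ys us]; rewrite inE => /orP[/eqP->|xs].
  rewrite eqxx andbF add0n addnC; congr (_ + _); apply: eq_in_count => z zs /=.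
  by case: eqVneq => [zy|_]; [rewrite -zy zs in ys|rewrite andbT].
rewrite -(IH us xs) addnA; congr (_ + _ + _).
by case: eqVneq => [yx|_]; [rewrite yx xs in ys|rewrite andbT].
Qed.

Lemma count_labelsD1 h x : x \in labels h -> count (predC1 x) (labels h) = size h.
Proof.
move=> xh; have := count_predD1 predT (uniq_labels h) xh.
by rewrite count_predT size_labels (@eq_count _ _ (predC1 x)) //= addn1 => -[].
Qed.

Lemma subtree_compl h v :
  count (predC (descends h v)) (labels h) = (size h).+1 - subtree_size h v.
Proof. by rewrite -(size_labels h) -(count_predC (descends h v)) addKn. Qed.

Lemma subtree_size_le h v : subtree_size h v <= (size h).+1.
Proof. by rewrite -(size_labels h) count_size. Qed.

Lemma subtree_size_gt0 h v : v \in labels h -> 0 < subtree_size h v.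
Proof.
move=> vh; rewrite -has_count; apply/hasP; exists v => //; exact: descends_refl.
Qed.

Section Betweenness.
Variables (h : seq nat) (wf_h : wf_history h).
Let B := betweenness (tree_of h).
Let N := (size h).+1.
Let m := subtree_size h.

(** Take for [A] the complement of the subtree of [v]: a simple path between two outside vertices
    cannot enter the subtree, hence avoids [v]. *)
Lemma betweenness_vertex_le v : v \in labels h ->
  B v + (N - m v) ^ 2 <= size h ^ 2.
Proof.
move=> vh; have vN : v <= N by move: vh; rewrite mem_labels => /andP[].
have := @betweenness_le (tree_of h) v (predC (descends h v)).
rewrite vertices_tree_of count_labelsD1 //.
have := count_predD1 (predC (descends h v)) (uniq_labels h) vh.
rewrite /= descends_refl addn0 subtree_compl => ->; apply => s t _ _ /= As At.
move=> [_ _ [p /and3P[Hp /eqP lp up]]].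
rewrite -lp in At.
have /allP Hall := path_no_crossing (@adj_tree_sym h)
  (fun a b => @descends_cross h v a b wf_h vN) Hp up As At.
by move=> /Hall /=; rewrite descends_refl.
Qed.

(** A path out of the subtree of [v] passes through [v]; the predecessor discounts [v] itself. *)
Lemma betweenness_vertex_ge v : v \in labels h ->
  2 * (m v).-1 * (N - m v) <= B v.
Proof.
move=> vh; have vN : v <= N by move: vh; rewrite mem_labels => /andP[].
have := @leq_betweenness (tree_of h) v (descends h v) (@adj_tree_sym h).
rewrite vertices_tree_of.
have := count_predD1 (predC (descends h v)) (uniq_labels h) vh.
have := count_predD1 (descends h v) (uniq_labels h) vh.
rewrite /= descends_refl addn0 addn1 subtree_compl -/(subtree_size h v) -/(m v).
move=> Em ->; rewrite -Em /=; apply => s t sh th sv tv As At.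
split; rewrite 1?eq_sym //; have [p] := tree_simple_path wf_h sh th.
move=> Hsp; exists p => //; case/and3P: Hsp => Hp /eqP lp up; rewrite -lp in At.
by have /andP[] := path_crosses (fun a b => @descends_cross h v a b wf_h vN) Hp As At.
Qed.

Lemma root_in_labels : 1 \in labels h.
Proof. by rewrite mem_labels. Qed.

Lemma root_not_descends u : 2 <= u -> descends h u 1 = false.
Proof. by move=> u2; apply/negP => /(descends_leq wf_h); lia. Qed.

(** A simple path between two vertices of the subtree of [u] never enters the complement, where the
    root lies because [2 <= u]. *)
Lemma betweenness_root_le u : 2 <= u -> u \in labels h ->
  B 1 + m u ^ 2 <= size h ^ 2.
Proof.
move=> u2 uh; have uN : u <= N by move: uh; rewrite mem_labels => /andP[].
have := @betweenness_le (tree_of h) 1 (descends h u).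
rewrite vertices_tree_of count_labelsD1 ?root_in_labels //.
have := count_predD1 (descends h u) (uniq_labels h) root_in_labels.
rewrite root_not_descends // addn0 => ->; apply => s t _ _ As At.
move=> [_ _ [p /and3P[Hp /eqP lp up]]]; rewrite -lp in At.
have cross a b : adj (tree_of h) a b -> ~~ descends h u a ->
    ~~ ~~ descends h u b -> a = parent h u /\ b = u.
  by rewrite adj_tree_sym negbK => ba Na Ab; have [] := descends_cross wf_h uN ba Ab Na.
have := path_no_crossing (A := predC (descends h u)) (@adj_tree_sym h) cross Hp up.
rewrite /= !negbK => /(_ As At) /andP[Hs /allP Hall].
rewrite inE => /orP[/eqP E|/Hall]; rewrite /= ?root_not_descends //.
by move: As; rewrite -E root_not_descends.
Qed.

(** The cut edge above [u] now ends at the root, so every path out of the branch visits the root.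
    Discounting the root leaves [size h - m u] vertices outside the branch. *)
Lemma betweenness_root_ge u : 2 <= u -> u \in labels h -> parent h u = 1 ->
  2 * m u * (size h - m u) <= B 1.
Proof.
move=> u2 uh pu; have uN : u <= N by move: uh; rewrite mem_labels => /andP[].
have := @leq_betweenness (tree_of h) 1 (descends h u) (@adj_tree_sym h).
rewrite vertices_tree_of.
have := count_predD1 (predC (descends h u)) (uniq_labels h) root_in_labels.
have := count_predD1 (descends h u) (uniq_labels h) root_in_labels.
rewrite /= root_not_descends // addn0 addn1 subtree_compl -/(subtree_size h u) -/(m u).
move=> -> Em; rewrite -[count _ _]/(count _ _).+1.-1 Em subSKn.
apply => s t sh th s1 t1 As At.
split; rewrite 1?eq_sym //; have [p] := tree_simple_path wf_h sh th.
move=> Hsp; exists p => //; case/and3P: Hsp => Hp /eqP lp up; rewrite -lp in At.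
have /andP[_] := path_crosses (fun a b => @descends_cross h u a b wf_h uN) Hp As At.
by rewrite pu.
Qed.

End Betweenness.

Lemma branchP h v : wf_history h -> 2 <= v <= (size h).+1 ->
  [/\ 2 <= branch h v <= v, parent h (branch h v) = 1 & descends h (branch h v) v].
Proof.
elim: h v => [|i h IH] v /=; first by lia.
move=> /andP[/andP[i0 Hi] Hh] Hv; case: eqVneq => [Ev|Nv].
  case: eqVneq => [i1|Ni]; first by rewrite -Ev eqxx; split; lia.
  have [|Hu Hp Hd] := IH i Hh; first by lia.
  have -> : (branch h i == (size h).+2) = false by lia.
  by rewrite Hp Hd orbT; split=> //; lia.
have [|Hu Hp Hd] := IH v Hh; first by lia.
have -> : (branch h v == (size h).+2) = false by lia.
by [].
Qed.

(** Used in [branch_stat_step] to see that a subtree is nested in its branch. The condition [2 <= v]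
    excludes the root, whose subtree meets every branch. *)
Lemma branch_descends h v w : wf_history h -> 2 <= v -> w <= (size h).+1 ->
  descends h v w -> branch h w = branch h v.
Proof.
elim: h w => [|i h IH] w /=; first by lia.
move=> /andP[/andP[i0 Hi] Hh] Hv Hw; case: eqVneq => [Ew|Nw].
  case/orP => [/eqP->|Hd]; first by rewrite Ew eqxx.
  have vi := descends_leq Hh Hi Hd.
  have -> : (i == 1) = false by lia.
  have -> : (v == (size h).+2) = false by lia.
  exact: IH.
move=> Hd; have vw : v <= w by apply: (descends_leq Hh) Hd; lia.
have -> : (v == (size h).+2) = false by lia.
by apply: IH => //; lia.
Qed.

(** * The rank of the root through subtree sizes *)

(** Everything sorted before [x] is related to [x]; by antisymmetry nothing after it is. *)
Lemma index_sort_count (T : eqType) (leT : rel T) (s : seq T) (x : T) :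
  transitive leT -> total leT -> antisymmetric leT -> uniq s -> x \in s ->
  (index x (sort leT s)).+1 = count (leT^~ x) s.
Proof.
move=> trT totT asT us xs.
have /permP -> : perm_eq s (sort leT s) by rewrite perm_sym perm_sort.
have := sort_sorted totT s; have := xs; rewrite -(mem_sort leT).
have := us; rewrite -(sort_uniq leT).
move: (sort leT s) => {us xs}s us xs; case/splitPr: xs us => s1 s2.
rewrite cat_uniq /= negb_or => /and3P[_ /andP[xs1 _] /andP[xs2 _]].
rewrite (sorted_pairwise trT) pairwise_cat /= allrel_consr => /and4P[/andP[H1 _] _ H2 _].
rewrite index_cat (negPf xs1) /= eqxx addn0 count_cat /=.
have -> : leT x x by have := totT x x; rewrite orbb.
have /eqP -> : count (leT^~ x) s1 == size s1 by rewrite -all_count.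
rewrite (@eq_in_count _ _ pred0) ?count_pred0 ?addn0 ?addn1 // => y ys2 /=.
apply/negP => yx; have yE : y = x by apply: asT; rewrite yx (allP H2).
by rewrite -yE ys2 in xs2.
Qed.

(** The root has the smallest label, so it comes last among the vertices tied with it and its rank
    counts all of them. *)
Lemma betweenness_rank_root h :
  betweenness_rank (tree_of h) 1 =
  count (fun v => betweenness (tree_of h) 1 <= betweenness (tree_of h) v) (labels h).
Proof.
have trR : transitive (ranked_no_later (tree_of h)).
  by move=> x y z; rewrite /ranked_no_later; lia.
have totR : total (ranked_no_later (tree_of h)).
  by move=> x y; rewrite /ranked_no_later; lia.
have asR : antisymmetric (ranked_no_later (tree_of h)).
  by move=> x y; rewrite /ranked_no_later; lia.
rewrite /betweenness_rank vertices_tree_of.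
rewrite (index_sort_count trR totR asR) ?uniq_labels ?root_in_labels //.
apply: eq_in_count => v; rewrite mem_labels /ranked_no_later; lia.
Qed.

Lemma branch_size_bound s a m Bv B1 : B1 <= Bv -> 0 < m -> m <= s.+1 ->
  a <= s.+1 -> Bv + (s.+1 - m) ^ 2 <= s ^ 2 -> 2 * a * (s - a) <= B1 ->
  a * (s.+1 - a) <= s.+1 * m.
Proof.
case: m => // m B1v _ ms aN; rewrite subSS => Bvm B1a.
(* Here [m] is one less than in the statement, and [Bv <= s^2 - (s - m)^2 <= 2 s m]. *)
have H1 : 2 * (a * (s - a)) <= 2 * (s * m).
  rewrite mulnA; apply: leq_trans B1a (leq_trans B1v _).
  move: Bvm; rewrite -{2}(subnK (ms : m <= s)).
  move: (s - m) (subnK (ms : m <= s)) => k <-.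
  by rewrite -!mulnn !(mulnDl, mulnDr) [m * k]mulnC; lia.
rewrite leq_mul2l /= in H1.
(* Passing from [s - a] to [s.+1 - a] costs at most [a <= s.+1], which is absorbed when [m] is
   restored to its original value. *)
have H2 : a * (s.+1 - a) <= a * (s - a) + a by rewrite addnC -mulnS leq_mul2l; lia.
by apply: leq_trans H2 _; rewrite mulnS mulSn; lia.
Qed.

Lemma betweenness_bounds_cmp s a m Bv B1 : 0 < m -> a <= s.+1 ->
  B1 + a ^ 2 <= s ^ 2 -> 2 * m.-1 * (s.+1 - m) <= Bv ->
  2 * (s.+1 - a) <= m -> 2 * m <= s.+1 -> B1 <= Bv.
Proof.
case: m => // m _ aN B1a Bvm am ms; apply: leq_trans Bvm => /=; rewrite subSS.
have as_ : a <= s by rewrite -leq_sqr; apply: leq_trans B1a; exact: leq_addl.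
(* [s^2 - a^2 = (s - a) (s + a)] and [s + a <= 2 s]. *)
have H1 : B1 <= 2 * (s - a) * s.
  move: B1a; move: (s - a) (subnK as_) => k <-.
  by rewrite -!mulnn !(mulnDl, mulnDr); lia.
(* With [m] one less than in the statement, [2 (s - a) <= m] and [s <= 2 (s - m)]. *)
apply: leq_trans H1 _; apply: (@leq_trans (m * s)).
  by rewrite leq_mul2r; lia.
by rewrite mulnAC [_ * m]mulnC leq_mul2l; lia.
Qed.

Lemma rank_root_le h : wf_history h ->
  betweenness_rank (tree_of h) 1 <=
  (count (fun v => subtree_size h (branch h v) *
     ((size h).+1 - subtree_size h (branch h v)) <= (size h).+1 * subtree_size h v)
     (iota 2 (size h))).+1.
Proof.
move=> wf_h; rewrite betweenness_rank_root labelsE /= leqnn add1n ltnS.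
rewrite -!sum1_count big_mkcond [leqRHS]big_mkcond /= big_seq [leqRHS]big_seq.
apply: leq_sum => v; rewrite mem_iota => Hv.
have [|Hu pu _] := branchP (v := v) wf_h; first by lia.
have uh : branch h v \in labels h by rewrite mem_labels; lia.
have vh : v \in labels h by rewrite mem_labels; lia.
case: ifP => // Hle.
by rewrite (branch_size_bound Hle (subtree_size_gt0 vh) (subtree_size_le h v)
  (subtree_size_le h _) (betweenness_vertex_le wf_h vh)
  (betweenness_root_ge wf_h (proj1 (andP Hu)) uh pu)).
Qed.

Lemma rank_root_ge h : wf_history h ->
  count (fun v => (2 * ((size h).+1 - subtree_size h (branch h v)) <= subtree_size h v)
     && (2 * subtree_size h v <= (size h).+1)) (iota 2 (size h))
  <= betweenness_rank (tree_of h) 1.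
Proof.
move=> wf_h; rewrite betweenness_rank_root labelsE /=.
apply: leq_trans (leq_addl _ _).
rewrite -!sum1_count big_mkcond [leqRHS]big_mkcond /= big_seq [leqRHS]big_seq.
apply: leq_sum => v; rewrite mem_iota => Hv.
have [|Hu pu _] := branchP (v := v) wf_h; first by lia.
have uh : branch h v \in labels h by rewrite mem_labels; lia.
have vh : v \in labels h by rewrite mem_labels; lia.
case: ifP => // /andP[H1 H2].
by rewrite (betweenness_bounds_cmp (subtree_size_gt0 vh) (subtree_size_le h _)
  (betweenness_root_le wf_h (proj1 (andP Hu)) uh)
  (betweenness_vertex_ge wf_h vh) H1 H2).
Qed.

Lemma subtree_size_new i h : wf_history (i :: h) ->
  subtree_size (i :: h) (size h).+2 = 1.
Proof.
move=> wf_h; have := wf_h => /= /andP[/andP[i0 Hi] Hh].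
rewrite /subtree_size labelsS -cats1 count_cat /= !eqxx /=.
rewrite (@eq_in_count _ _ pred0) ?count_pred0 // => w; rewrite mem_labels => Hw.
apply/negP => /=; have -> : (w == (size h).+2) = false by lia.
by move/(descends_leq Hh); lia.
Qed.

Lemma subtree_size_old i h v : v \in labels h ->
  subtree_size (i :: h) v = subtree_size h v + descends h v i.
Proof.
rewrite mem_labels => vh; rewrite /subtree_size labelsS -cats1 count_cat /= eqxx /=.
have -> : (v == (size h).+2) = false by lia.
rewrite addn0; congr (_ + _); apply: eq_in_count => w; rewrite mem_labels => Hw /=.
by have -> : (w == (size h).+2) = false by lia.
Qed.

End RecursiveTrees.

(** * Subtree sizes of a uniform recursive tree *)

Section BranchLaw.
Variable R : realType.
Implicit Types (h : seq nat) (f : nat -> R) (F : nat -> nat -> R).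

(** Letting the test function [F] vary encodes the joint distribution of branch size and subtree
    size, on which one attachment acts linearly. *)
Definition branch_stat h F : R :=
  \sum_(v <- iota 2 (size h)) F (subtree_size h (branch h v)) (subtree_size h v).

(** Since [p] implies [q], an attachment at [i] has three outcomes: subtree and branch grow, only
    the branch grows, or neither does. *)
Lemma sum_nested_preds (T : eqType) (p q : pred T) (s : seq T) F :
  {in s, forall i, p i -> q i} ->
  \sum_(i <- s) F (q i) (p i) = (count p s)%:R * F 1 1 +
    ((count q s)%:R - (count p s)%:R) * F 1 0 +
    ((size s)%:R - (count q s)%:R) * F 0 0.
Proof.
elim: s => [|x s IH] pq; first by rewrite big_nil /=; ring.
rewrite big_cons IH /= => [|i si]; last by apply: pq; rewrite inE si orbT.
have := pq x (mem_head _ _); rewrite -addn1 !natrD.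
by case: (p x); case: (q x) => /= H; [|case: (notF (H isT))| |]; ring.
Qed.

(** Of all places for a new vertex, [m] lie below a given [v], [a - m] elsewhere in its branch, and
    the rest outside the branch. The new vertex itself has subtree size 1; its branch has size
    [a.+1] if its parent is in a branch of size [a], and size 1 if its parent is the root. *)
Lemma branch_stat_step h F : wf_history h ->
  \sum_(i <- labels h) branch_stat (i :: h) F =
  branch_stat h (fun a m => m%:R * F a.+1 m.+1 + (a%:R - m%:R) * F a.+1 m +
    F a.+1 1%N + ((size h).+1%:R - a%:R) * F a m) + F 1%N 1%N.
Proof.
move=> wf_h; pose N := (size h).+1.
have wfi i : i \in labels h -> wf_history (i :: h).
  by rewrite mem_labels /= => ->.
have br v : v \in iota 2 (size h) ->
    [/\ v \in labels h, branch h v \in labels h, (v == N.+1) = false & (2 <= v)%N].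
  rewrite mem_iota !mem_labels => Hv.
  have [|Hu _ _] := branchP (v := v) wf_h; first by lia.
  by rewrite /N; split; lia.
have step i : i \in labels h -> branch_stat (i :: h) F =
    \sum_(v <- iota 2 (size h)) F
       (subtree_size h (branch h v) + descends h (branch h v) i)%N
       (subtree_size h v + descends h v i)%N +
    (if i == 1%N then F 1%N 1%N else F (subtree_size h (branch h i)).+1 1%N).
  move=> Hi; rewrite /branch_stat [size _]/= -[(size h).+1]addn1 iotaD big_cat.
  rewrite big_seq1 /= add2n eqxx subtree_size_new ?wfi //; congr (_ + _).
    rewrite !big_seq; apply: eq_bigr => v /br[vh uh vN _].
    by rewrite vN !subtree_size_old.
  case: eqVneq => [_|i1]; first by rewrite subtree_size_new ?wfi.
  have [|_ uh _ _] := br i; first by rewrite mem_iota; rewrite mem_labels in Hi; lia.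
  rewrite subtree_size_old //.
  have [|_ _ ->] := branchP (v := i) wf_h; last by rewrite addn1.
  by rewrite mem_labels in Hi; lia.
rewrite big_seq (eq_bigr _ step) -big_seq big_split exchange_big /=.
rewrite /branch_stat -[in RHS](eq_bigr _ (fun _ _ => addrAC _ _ _)) /=.
rewrite big_split -addrA; congr (_ + _).
  rewrite !big_seq; apply: eq_bigr => v Hv; have [vh uh vN v2] := br v Hv.
  have H := @sum_nested_preds _ (descends h v) (descends h (branch h v)) (labels h)
    (fun b c => F (subtree_size h (branch h v) + b)%N (subtree_size h v + c)%N).
  rewrite H ?size_labels ?addn1 ?addn0 // => i.
  rewrite mem_labels => /andP[_ Hi] Hd.
  have i2 := leq_trans v2 (descends_leq wf_h Hi Hd).
  have [|_ _] := branchP (v := i) wf_h; first by rewrite i2.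
  by rewrite (branch_descends wf_h v2 Hi Hd).
rewrite labelsE big_cons eqxx addrC; congr (_ + _).
by rewrite !big_seq; apply: eq_bigr => v /br[_ _ _ v2]; case: eqP => // v1;
  rewrite v1 in v2.
Qed.

(* The law of the subtree size of a uniform vertex of a recursive tree of size
   [a], weighing [f]: size [a] has probability [1/a], size [m < a] has
   probability [1/(m(m+1))]. *)
Definition subtree_law f (a : nat) : R :=
  \sum_(1 <= m < a) f m / (m%:R * m.+1%:R) + f a / a%:R.

Lemma subtree_law1 f : subtree_law f 1 = f 1%N.
Proof. by rewrite /subtree_law big_geq // add0r divr1. Qed.

Lemma subtree_lawD f g a :
  subtree_law (fun m => f m + g m) a = subtree_law f a + subtree_law g a.
Proof.
rewrite /subtree_law mulrDl addrACA -big_split; congr (_ + _).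
by apply: eq_bigr => m _; rewrite mulrDl.
Qed.

Lemma subtree_lawZ c f a : subtree_law (fun m => c * f m) a = c * subtree_law f a.
Proof.
rewrite /subtree_law mulrDr mulrA big_distrr /=; congr (_ + _).
by apply: eq_bigr => m _; rewrite mulrA.
Qed.

(** The mass [1/a] at [a] splits into [1/(a(a+1))], which stays, and [1/(a+1)], which moves to
    [a+1]. *)
Lemma subtree_lawS f a : (0 < a)%N ->
  subtree_law f a.+1 = subtree_law f a - f a / a.+1%:R + f a.+1 / a.+1%:R.
Proof.
move=> a0; rewrite /subtree_law big_nat_recr //=; congr (_ + _).
rewrite -addrA; congr (_ + _); field.
have : 0 < a%:R :> R by rewrite ltr0n.
by move=> a0R; rewrite !gt_eqF //; lra.
Qed.

(** Attach a vertex uniformly to a recursive tree of size [a]: a subtree of size [m] grows with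
    probability [m/a], and a subtree of size 1 appears. Both sides are the expected sum of [f] over
    the [a.+1] resulting subtree sizes. *)
Lemma subtree_law_grow f a : (0 < a)%N ->
  subtree_law (fun m => m%:R * f m.+1 + (a%:R - m%:R) * f m + f 1%N) a =
  a.+1%:R * subtree_law f a.+1.
Proof.
elim: a => // -[_ _|a IH _].
  by rewrite subtree_law1 subtree_lawS // subtree_law1; field.
(* Raising [a] by one adds exactly one [f m] to the test function. *)
rewrite (_ : (fun m => _) = fun m =>
    (m%:R * f m.+1 + (a.+1%:R - m%:R) * f m + f 1%N) + f m); last first.
  by apply/funext => m; rewrite -[a.+2]addn1 natrD; ring.
rewrite subtree_lawD subtree_lawS // IH // [in RHS]subtree_lawS //.
rewrite -![a.+2]addn1 -![a.+1]addn1 !natrD; field; rewrite ?gt_eqF //; lra.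
Qed.

(** On average [1/a] branches have size [a], each a recursive tree on its [a] vertices; the factors
    [1/a] and [a] cancel, so every [a < n] has weight 1. *)
Definition branch_law n F : R := \sum_(1 <= a < n) subtree_law (F a) a.

(** [subtree_law_grow] handles growing branches. The differences of [a * p a] then telescope: the
    lower end [p 1] cancels the term [F 1 1] of a new branch, and the upper end supplies the summand
    [a = n]. *)
Lemma branch_law_step n F : (0 < n)%N ->
  branch_law n (fun a m => m%:R * F a.+1 m.+1 + (a%:R - m%:R) * F a.+1 m +
    F a.+1 1%N + (n%:R - a%:R) * F a m) + F 1%N 1%N = n%:R * branch_law n.+1 F.
Proof.
move=> n0; rewrite /branch_law.
pose p a := subtree_law (F a) a.
have E a : (0 < a)%N -> subtree_law (fun m => m%:R * F a.+1 m.+1 +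
    (a%:R - m%:R) * F a.+1 m + F a.+1 1%N + (n%:R - a%:R) * F a m) a =
    (a.+1%:R * p a.+1 - a%:R * p a) + n%:R * p a.
  move=> a0; rewrite subtree_lawD subtree_lawZ (subtree_law_grow (F a.+1)) //.
  by rewrite -/(p a.+1) -[subtree_law (fun m => F a m) a]/(p a); ring.
rewrite (eq_big_nat _ _ (F2 := fun a => (a.+1%:R * p a.+1 - a%:R * p a) + n%:R * p a)).
  rewrite big_split /= telescope_sumr // -big_distrr /= [in RHS]big_nat_recr //=.
  rewrite -[F 1%N 1%N](subtree_law1 (F 1%N)) -/(p 1%N) -/(p n).
  rewrite -[\sum_(1 <= a < n) subtree_law _ _]/(\sum_(1 <= a < n) p a); ring.
by move=> a /andP[a0 _]; exact: E.
Qed.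

(** * Averaging over all histories *)

Fixpoint histories n : seq (seq nat) :=
  if n is n'.+1 then [seq i :: h | h <- histories n', i <- iota 1 n'.+1]
  else [:: [::]].

Lemma mem_histories n h : (h \in histories n) = (size h == n) && wf_history h.
Proof.
elim: n h => [|n IH] h; first by case: h.
apply/allpairsPdep/idP => /= [[h' [i [+ + ->]]]|].
  by rewrite IH inE mem_iota => /andP[/eqP sh wfh] Hi /=; rewrite sh wfh eqxx andbT; lia.
case: h => // i h /= /andP[/eqP[sh] /andP[Hi wf_h]].
exists h, i; split=> //; first by rewrite IH sh eqxx.
by rewrite inE mem_iota; lia.
Qed.

Lemma uniq_histories n : uniq (histories n).
Proof.
elim: n => // n IH; apply: allpairs_uniq_dep => [//|h _|[h i] [h' j] _ _ [-> ->] //].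
exact: iota_uniq.
Qed.

Lemma size_histories n : size (histories n) = n`!.
Proof.
elim: n => // n IH; rewrite size_allpairs_dep sumnE big_map.
rewrite (eq_bigr (fun=> n.+1)) => [|h _]; last exact: size_iota.
by rewrite big_const_seq count_predT iter_addn_0 IH factS.
Qed.

(** Induction for all [F] at once: [branch_stat_step] and [branch_law_step] transform the test
    function in the same way. *)
Lemma sum_histories_branch_stat n F :
  \sum_(h <- histories n) branch_stat h F = n`!%:R * branch_law n.+1 F.
Proof.
elim: n F => [|n IH] F.
  by rewrite big_seq1 /branch_stat /branch_law big_nil big_geq // mulr0.
rewrite big_allpairs_dep /=.
transitivity (\sum_(h <- histories n) (branch_stat h (fun a m =>
    m%:R * F a.+1 m.+1 + (a%:R - m%:R) * F a.+1 m +
    F a.+1 1%N + (n.+1%:R - a%:R) * F a m) + F 1%N 1%N)).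
  rewrite !big_seq; apply: eq_bigr => h; rewrite mem_histories => /andP[/eqP <- wf_h].
  by rewrite -branch_stat_step.
rewrite big_split /= IH big_const_seq count_predT iter_addr_0.
rewrite size_histories.
by rewrite -[F 1%N 1%N *+ _]mulr_natl -mulrDr branch_law_step // factS natrM; ring.
Qed.


(** * Harmonic sums and the two summation regions *)

(** The range stops before [n], so this is the harmonic number [H_(n-1)]. *)
Definition harmonic_sum n : R := \sum_(1 <= k < n) k%:R^-1.

Lemma ln_harmonic_sum n : (0 < n)%N -> ln n%:R <= harmonic_sum n.
Proof.
elim: n => // -[_ _|n IH _]; first by rewrite ln1 /harmonic_sum big_geq.
rewrite /harmonic_sum big_nat_recr //=; have n0 : 0 < n.+1%:R :> R by rewrite ltr0n.
have -> : n.+2%:R = n.+1%:R * (1 + n.+1%:R^-1) :> R.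
  by rewrite mulrDr mulr1 divff ?gt_eqF // -natr1.
rewrite lnM ?posrE // ?addr_gt0 ?invr_gt0 // lerD ?IH //.
by apply: le_ln1Dx; rewrite (@lt_trans _ _ 0) ?invr_gt0 // ltrN10.
Qed.

(** Sum [1/k <= - ln (1 - 1/k)] over [k >= 2]; the term [k = 1] gives the constant. *)
Lemma harmonic_sum_ln n : (0 < n)%N -> harmonic_sum n.+1 <= 1 + ln n%:R.
Proof.
elim: n => // -[_ _|n IH _].
  by rewrite /harmonic_sum big_nat1 ln1 invr1 addr0.
rewrite /harmonic_sum big_nat_recr //=; have n0 : 0 < n.+1%:R :> R by rewrite ltr0n.
have n1 : 0 < n.+2%:R :> R by rewrite ltr0n.
have E : n.+1%:R = n.+2%:R * (1 - n.+2%:R^-1) :> R.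
  by rewrite mulrBr mulr1 divff ?gt_eqF // -[n.+2%:R]natr1 addrK.
have p : 0 < 1 - n.+2%:R^-1 :> R by rewrite -(pmulr_rgt0 _ n1) -E.
have := IH isT; rewrite /harmonic_sum [in ln n.+1%:R]E lnM ?posrE //.
have := @le_ln1Dx R (- n.+2%:R^-1); rewrite ltrN2 invf_lt1 // ltr1n => /(_ isT).
move: (ln (1 - n.+2%:R^-1)) => x; move: (ln n.+2%:R) (n.+2%:R^-1) => y z.
move: (\sum_(1 <= i < n.+2) i%:R^-1) => t; lra.
Qed.

(** The weights [1/(m(m+1)) = 1/m - 1/(m+1)] telescope, and only [m >= c] count. *)
Lemma sum_tail_le (c : R) (P : pred nat) n : 0 < c ->
  (forall m, P m -> c <= m%:R) ->
  \sum_(1 <= m < n.+1) (P m)%:R / (m%:R * m.+1%:R) <= c^-1.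
Proof.
move=> c0 Pc.
(* The induction needs the remainder [1/(n+1)]; the maximum with 0 covers the stage before [n]
   reaches [c]. *)
suff: \sum_(1 <= m < n.+1) (P m)%:R / (m%:R * m.+1%:R) <=
      Num.max 0 (c^-1 - n.+1%:R^-1).
  move=> /le_trans; apply; rewrite ge_max invr_ge0 ltW //=.
  by rewrite lerBlDr lerDl invr_ge0.
elim: n => [|n IH]; first by rewrite big_geq // le_max lexx.
rewrite big_nat_recr //=; have n0 : 0 < n.+1%:R :> R by rewrite ltr0n.
have n1 : 0 < n.+2%:R :> R by rewrite ltr0n.
have E : (n.+1%:R * n.+2%:R)^-1 = n.+1%:R^-1 - n.+2%:R^-1 :> R.
  by rewrite -[n.+2%:R]natr1; field; rewrite nat1r natr1 !pnatr_eq0.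
have lt12 : n.+2%:R^-1 <= n.+1%:R^-1 :> R by rewrite lef_pV2 ?posrE // ler_nat.
have [/Pc Hc|_] := boolP (P n.+1).
  rewrite mul1r E; have H : n.+1%:R^-1 <= c^-1 by rewrite lef_pV2 ?posrE.
  move: IH; rewrite max_r ?subr_ge0 // => IH.
  by rewrite le_max; apply/orP; right; rewrite addrA lerD2r -lerBrDr.
rewrite mul0r addr0; apply: le_trans IH _.
by rewrite ge_max !le_max lexx lerD2l lerN2 lt12 orbT.
Qed.

(** For [m < a] the condition says [m >= c] with [c = a (N - a) / N], and this tail weighs at most
    [1/c = 1/a + 1/(N - a)]. The atom [m = a] adds at most [1/a], so three harmonic sums result. *)
Lemma branch_law_le N :
  branch_law N (fun a m => (a * (N - a) <= N * m)%N%:R) <= 3 * harmonic_sum N.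
Proof.
have -> : 3 * harmonic_sum N = \sum_(1 <= a < N) (a%:R^-1 + (N - a)%:R^-1 + a%:R^-1).
  rewrite !big_split /=.
  have -> : \sum_(1 <= a < N) (N - a)%:R^-1 = harmonic_sum N.
    rewrite /harmonic_sum big_nat_rev /=; apply: eq_big_nat => a Ha.
    by congr (_%:R^-1); lia.
  by rewrite -/(harmonic_sum N); ring.
apply: ler_sum_nat => a /andP[a0 aN]; rewrite /subtree_law.
have a0R : 0 < a%:R :> R by rewrite ltr0n.
have b0R : 0 < (N - a)%:R :> R by rewrite ltr0n subn_gt0.
have N0R : 0 < N%:R :> R by rewrite ltr0n; lia.
have c0 : 0 < a%:R * (N - a)%:R / N%:R :> R by rewrite divr_gt0 ?mulr_gt0.
apply: lerD; last first.
  by rewrite -[leRHS]mul1r ler_wpM2r ?invr_ge0 ?ler0n // lern1 leq_b1.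
have -> : a%:R^-1 + (N - a)%:R^-1 = (a%:R * (N - a)%:R / N%:R)^-1 :> R.
  have -> : N%:R = (N - a)%:R + a%:R :> R by rewrite -natrD subnK // ltnW.
  by field; rewrite !gt_eqF // addr_gt0.
rewrite -[in X in \sum_(_ <= _ < X) _](prednK a0); apply: sum_tail_le => // m Hm.
by rewrite ler_pdivrMr // -!natrM ler_nat [(m * N)%N]mulnC.
Qed.

Lemma subtree_law_ge0 f a : (forall m, 0 <= f m) -> 0 <= subtree_law f a.
Proof.
move=> f0; rewrite addr_ge0 ?divr_ge0 // sumr_ge0 // => m _.
by rewrite divr_ge0 // mulr_ge0.
Qed.

(** Only [a = N - k] with [k <= N/8] is kept. With [M = N %/ 2], the values [2 k <= m <= M] have
    total weight [1/(2k) - 1/(M+1)], at least [1/(4k)] because [4 k <= M + 1]. *)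
Lemma branch_law_ge N : (0 < N)%N -> 4^-1 * ln (N%:R / 8) <=
  branch_law N (fun a m =>
    ((2 * (N - a) <= m)%N && (2 * m <= N)%N)%:R).
Proof.
move=> N0; pose K := (N %/ 8)%N.
have N0R : 0 < N%:R :> R by rewrite ltr0n.
apply: (@le_trans _ _ (4^-1 * harmonic_sum K.+1)).
  rewrite ler_wpM2l ?invr_ge0 // (le_trans _ (ln_harmonic_sum (ltn0Sn K))) //.
  rewrite ler_ln ?posrE ?divr_gt0 // ler_pdivrMr // -natrM ler_nat.
  by rewrite ltnW // -ltn_divLR.
(* After the reversal the index [k] stands for [a = N - k]; the part beyond [K] is nonnegative and
   is dropped. *)
rewrite /branch_law big_nat_rev /= (big_cat_nat (n := K.+1)) //=; last first.
  by rewrite /K; lia.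
rewrite -[leLHS]addr0 lerD //; last first.
  by apply: sumr_ge0 => a _; apply: subtree_law_ge0.
rewrite /harmonic_sum big_distrr /=; apply: ler_sum_nat => k /andP[k0 kK].
have -> : (1 + N - k.+1 = N - k)%N by lia.
have kN : (8 * k <= N)%N by rewrite /K in kK; lia.
rewrite /subtree_law -[leLHS]addr0 lerD ?divr_ge0 //.
pose M := (N %/ 2)%N.
rewrite (big_cat_nat (n := 2 * k)) /=; [|lia|lia].
rewrite (big_cat_nat (m := 2 * k) (n := M.+1)) /=; [|rewrite /M; lia|rewrite /M; lia].
have pos i j : 0 <= \sum_(i <= m < j)
   ((2 * (N - (N - k)) <= m)%N && (2 * m <= N)%N)%:R / (m%:R * m.+1%:R) :> R.
  by apply: sumr_ge0 => m _; rewrite divr_ge0 // mulr_ge0.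
(* The summands below [2 k] and above [M] are dropped. *)
apply: (le_trans _ (ler_wpDl (pos _ _) (ler_wpDr (pos _ _) (lexx _)))).
rewrite (eq_big_nat _ _ (F2 := fun m => - m.+1%:R^-1 - (- m%:R^-1))); last first.
  move=> m Hm; have -> : (2 * (N - (N - k)) <= m)%N && (2 * m <= N)%N.
    by move: Hm; rewrite /M; lia.
  have m0 : 0 < m%:R :> R by rewrite ltr0n; lia.
  rewrite mul1r -[m.+1%:R]natr1; field.
  by rewrite ?nat1r ?natr1 !pnatr_eq0 /=; lia.
rewrite telescope_sumr; last by rewrite /M; lia.
have k0R : 0 < k%:R :> R by rewrite ltr0n.
have H : M.+1%:R^-1 <= (4 * k%:R)^-1 :> R.
  by rewrite lef_pV2 ?posrE ?mulr_gt0 // -natrM ler_nat /M; lia.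
have E : (2 * k)%:R^-1 = (4 * k%:R)^-1 + (4 * k%:R)^-1 :> R.
  by rewrite natrM; field; rewrite gt_eqF.
by rewrite opprK E -invfM addrA lerDr addrC subr_ge0.
Qed.

Lemma sum_rank_le n :
  \sum_(h <- histories n) (betweenness_rank (tree_of h) 1)%:R
    <= n`!%:R * (1 + 3 * harmonic_sum n.+1).
Proof.
pose F a m : R := (a * (n.+1 - a) <= n.+1 * m)%N%:R.
apply: (@le_trans _ _ (\sum_(h <- histories n) (1 + branch_stat h F))).
  rewrite !big_seq; apply: ler_sum => h; rewrite mem_histories => /andP[/eqP sh wf_h].
  have := rank_root_le wf_h; rewrite -(ler_nat R) => /le_trans; apply.
  by rewrite -natr1 addrC lerD2l /branch_stat -sum1_count natr_sum big_mkcond sh /=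
     ler_sum // => v _; rewrite /F; case: ifP.
rewrite big_split /= sum_histories_branch_stat big_const_seq count_predT.
rewrite size_histories iter_addr_0 mulrDr mulr1 lerD2l ler_wpM2l //.
exact: branch_law_le.
Qed.

Lemma sum_rank_ge n : n`!%:R * (4^-1 * ln (n.+1%:R / 8)) <= 
  \sum_(h <- histories n) (betweenness_rank (tree_of h) 1)%:R :> R.
Proof.
pose F a m : R := ((2 * (n.+1 - a) <= m)%N && (2 * m <= n.+1)%N)%:R.
apply: (@le_trans _ _ (\sum_(h <- histories n) branch_stat h F)).
  by rewrite sum_histories_branch_stat ler_wpM2l // branch_law_ge.
rewrite !big_seq; apply: ler_sum => h; rewrite mem_histories => /andP[/eqP sh wf_h].
have := rank_root_ge wf_h; rewrite -(ler_nat R); apply: le_trans.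
by rewrite /branch_stat -sum1_count natr_sum [leRHS]big_mkcond sh /=
  ler_sum // => v _; rewrite /F; case: ifP.
Qed.

End BranchLaw.

(** * From uniform histories to the probability space *)

(** The masses on [s] add up to 1, so [X] lies in [s] almost surely, and [g (X w)] agrees almost
    everywhere with a finite sum of weighted indicators. *)
Lemma expectation_finitely_supported (R : realType) d (Omega : measurableType d)
    (P : probability Omega R) (I : eqType) (X : Omega -> I) (s : seq I)
    (p g : I -> R) :
  (forall C : set I, measurable (X @^-1` C)) -> uniq s ->
  (forall i, i \in s -> P (X @^-1` [set i]) = (p i)%:E) ->
  \sum_(i <- s) p i = 1 -> (forall i, 0 <= g i) ->
  'E_P[fun w => g (X w)]%E = (\sum_(i <- s) g i * p i)%:E.
Proof.
move=> mX us PX sp g0; rewrite unlock.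
pose f (h : I -> R) i w : \bar R := (h i * \1_(X @^-1` [set i]) w)%:E.
have mf h i : measurable_fun setT (f h i).
  apply/measurable_EFinP; apply: measurable_funM => //.
have fE h w : (\sum_(i <- s) f h i w = (if X w \in s then h (X w) else 0)%:E)%E.
  rewrite /f sumEFin; congr (_%:E).
  case: ifPn => Xs.
    rewrite (bigD1_seq (X w)) //= big1_seq ?addr0 => [|i /andP[iX _]].
      by rewrite indicE mem_set ?mulr1.
    by rewrite indicE memNset ?mulr0 // => /= E; rewrite E eqxx in iX.
  rewrite big1_seq // => i /andP[_ si].
  by rewrite indicE memNset ?mulr0 // => /= E; rewrite E si in Xs.
have intf h : (forall i, 0 <= h i) ->
    (\int[P]_w (\sum_(i <- s) f h i w) = (\sum_(i <- s) h i * p i)%:E)%E.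
  move=> h0; rewrite ge0_integral_sum //; last first.
    by move=> i w _; rewrite lee_fin mulr_ge0 // indicE.
  rewrite -sumEFin !big_seq; apply: eq_bigr => i si.
  under eq_integral do rewrite /f EFinM.
  rewrite ge0_integralZl_EFin //.
  - by rewrite integral_indic // setIT EFinM; congr (_ * _)%E; exact: PX.
  - exact/measurable_EFinP.
(* This is [intf] for the constant function 1. *)
have PD : P (X @^-1` [set` s]) = 1%E.
  transitivity (\int[P]_w (\1_(X @^-1` [set` s]) w)%:E)%E.
    by rewrite integral_indic // setIT.
  rewrite -sp -[in RHS](eq_bigr _ (fun i _ => mul1r (p i))) -(intf (fun=> 1)) //.
  apply: eq_integral => w _; rewrite fE indicE /=; congr (_%:E).
  by case: ifPn => Xs; [rewrite mem_set|rewrite memNset //=; apply/negP].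
rewrite -intf //; apply: ge0_ae_eq_integral => //.
- move=> _ Y _; rewrite setTI; exact: (mX (fun i => Y (g i)%:E)).
- exact: emeasurable_sum.
- by move=> w _; rewrite lee_fin.
- by move=> w _; rewrite fE lee_fin; case: ifP.
have PDC : P (~` (X @^-1` [set` s])) = 0%E by rewrite probability_setC // PD subee.
exists (~` (X @^-1` [set` s])); split; [exact: measurableC|exact: PDC|].
move=> w /= Hw Xs; apply: Hw => _ /=; rewrite fE.
by move: Xs => /= ->.
Qed.

Section RandomHistory.
Context (R : realType) (d : measure_display) (Omega : measurableType d).
Context (P : probability Omega R) (T : nat -> Omega -> ngraph).
Context (U : nat -> {RV P >-> nat}) (hU : URRT U T).

Definition history n (w : Omega) : seq nat := rev [seq U k w | k <- iota 1 n].

Lemma historyS n w : history n.+1 w = U n.+1 w :: history n w.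
Proof.
rewrite /history -[in LHS](addn1 n) iotaD map_cat /= rev_cat /=.
by rewrite add1n.
Qed.

Lemma tree_of_history n w : T n.+1 w = tree_of (history n w).
Proof.
elim: n => [|n IH]; first by rewrite (URRT_root hU).
by rewrite (URRT_step hU) // historyS /= IH size_rev size_map size_iota.
Qed.

(** The event is split over the countably many values of the last attachment. *)
Lemma measurable_history n (C : set (seq nat)) : measurable (history n @^-1` C).
Proof.
elim: n C => [|n IH] C.
  have [C0|C0] := pselect (C [::]).
    by rewrite (_ : _ @^-1` _ = setT) //; apply/seteqP; split => w.
  by rewrite (_ : _ @^-1` _ = set0) //; apply/seteqP; split => w.
rewrite (_ : _ @^-1` _ = \bigcup_i (U n.+1 @^-1` [set i] `&`
    history n @^-1` [set h | C (i :: h)])); last first.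
  apply/seteqP; split => w /=; rewrite historyS; first by exists (U n.+1 w).
  by move=> [i _ /= [-> ]].
apply: bigcupT_measurable => i; apply: measurableI => //.
exact: measurable_funPTI.
Qed.

Lemma probability_history n h : h \in histories n ->
  P (history n @^-1` [set h]) = (n`!%:R^-1)%:E.
Proof.
elim: n h => [|n IH] h.
  rewrite inE => /eqP->; rewrite (_ : _ @^-1` _ = setT).
    by rewrite probability_setT invr1.
  by apply/seteqP; split => w.
case/allpairsPdep => [h' [i [Hh' Hi ->]]].
(* The past is put in insertion order, the form in which [URRT_indep] provides independence. *)
rewrite (_ : _ @^-1` _ = U n.+1 @^-1` [set i] `&`
  (fun w => [seq U k w | k <- iota 1 n]) @^-1` [set c | rev c = h']); last first.
  by apply/seteqP; split => w /=; rewrite historyS; case=> -> <-.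
rewrite (URRT_indep hU) // (URRT_uniform hU); last first.
  by move: Hi; rewrite mem_iota; lia.
have /= := IH _ Hh'; rewrite /history => ->.
by rewrite -EFinM -invfM -natrM mulnC factS mulnC.
Qed.

Lemma expectation_history n (g : seq nat -> R) : (forall h, 0 <= g h) ->
  'E_P[fun w => g (history n w)]%E =
  (n`!%:R^-1 * \sum_(h <- histories n) g h)%:E.
Proof.
move=> g0; have n0 : n`!%:R != 0 :> R by rewrite pnatr_eq0 -lt0n fact_gt0.
rewrite (@expectation_finitely_supported _ _ _ P _ (history n) (histories n)
  (fun=> n`!%:R^-1) g) //.
- by rewrite -big_distrl mulrC.
- exact: measurable_history.
- exact: uniq_histories.
- exact: probability_history.
- rewrite big_const_seq count_predT size_histories iter_addr_0.
  by rewrite -[_^-1 *+ _]mulr_natl divff.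
Qed.

End RandomHistory.

Unset Implicit Arguments.

Theorem theorem20 (R : realType) (d : measure_display)
    (Omega : measurableType d) (P : probability Omega R)
    (T : nat -> Omega -> ngraph) (hT : is_URRT P T) :
  (fun n : nat => fine ('E_P[(fun w => (betweenness_rank (T n w) 1)%:R)])%E)
    \is 'Theta_\oo (fun n : nat => ln n%:R : R).
Proof.
case: hT => U hU.
(* From [ln (1 - 1/2) <= - 1/2]. *)
have ln2 : 2^-1 <= ln 2 :> R.
  have := @le_ln1Dx R (- 2^-1); rewrite ltrN2 invf_lt1 // ltr1n => /(_ isT).
  rewrite (_ : 1 - 2^-1 = 2^-1); last by field.
  by rewrite lnV ?posrE // lerN2.
(* Let [N >= 64] be the number of vertices, so that [ln N >= 6 ln 2 >= 3]. Then
   [ln (N/8) = ln N - 3 ln 2 >= (ln N)/2], which gives the constant [1/8], and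
   [1 + 3 (1 + ln N) <= 7 ln N]. *)
apply/asboolP; exists (8^-1, 7); first by rewrite /= invr_gt0 !ltr0n.
(* From here on the tree has [n.+1] vertices and its history has length [n]. *)
exists 64%N => // -[//|n] /= N64.
have n0 : 0 < n`!%:R :> R by rewrite ltr0n fact_gt0.
have N0 : 0 < n.+1%:R :> R by rewrite ltr0n.
have ln8 : ln 8 = 3 * ln 2 :> R.
  by rewrite (_ : 8 = 2 ^+ 3) ?lnXn ?mulr_natl // -natrX.
have lnN : 6 * ln 2 <= ln n.+1%:R :> R.
  have -> : 6 * ln 2 = ln (64%:R : R).
    by rewrite (_ : 64%:R = 2 ^+ 6) ?lnXn ?mulr_natl // -natrX.
  by rewrite ler_ln ?posrE ?ltr0n // ler_nat.
set E := fine _.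
have -> : E = n`!%:R^-1 * \sum_(h <- histories n) (betweenness_rank (tree_of h) 1)%:R.
  rewrite /E; under [X in 'E_P[X]%E]eq_fun do rewrite (tree_of_history hU).
  by rewrite (@expectation_history _ _ _ _ _ _ hU n
    (fun h => (betweenness_rank (tree_of h) 1)%:R)).
have lnN0 : 0 <= ln n.+1%:R :> R by rewrite (le_trans _ lnN) ?mulr_ge0 //; lra.
rewrite (ger0_norm lnN0) ger0_norm; last by rewrite mulr_ge0 ?invr_ge0 ?sumr_ge0 // ltW.
split => /=.
  rewrite ler_pdivlMl //; apply: le_trans (sum_rank_ge R n).
  rewrite ler_pM2l // ln_div ?posrE // ln8.
  by move: (ln n.+1%:R) (ln 2) lnN => x y; lra.
rewrite ler_pdivrMl //; apply: le_trans (sum_rank_le R n) _.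
rewrite ler_pM2l //.
have := @harmonic_sum_ln R n.+1 isT.
(* The bound from [harmonic_sum_ln] includes the term [1/(n+1)], which is not in the rank bound and
   is discarded as nonnegative. *)
rewrite /harmonic_sum big_nat_recr //= -/(harmonic_sum R n.+1).
have : 0 <= n.+1%:R^-1 :> R by rewrite invr_ge0 ltW.
move: (harmonic_sum R n.+1) (ln n.+1%:R) (ln 2) (n.+1%:R^-1) lnN ln2 => x y z t; lra.
Qed.
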